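(* Let $f$ be a type-2 function and let $(\alpha_n)_{n\geqslant0}$ be a sequence with $0\leqslant\alpha_n\leqslant1$ and $\alpha_n\sim f'(n)$. Then in $(\mathcal{S},(\alpha_n)_{n\geqslant0})$, for every integer $d\geqslant1$, $$ \mathbb{E}(r_d(n;\omega))\asymp f'(n)f(n)^{d-1} \quad (n\to+\infty).$$
   Context: $\mathcal{S}$ denotes the set of infinite subsets of $\mathbb{Z}_{\geqslant 0}$. For $\omega\in\mathcal{S}$, $r(n;\omega)=r_1(n;\omega)$ is the indicator of $n\in\omega$, and for $d\geqslant2$, $r_d(n;\omega)=\sum_{k_1+\dots+k_d=n} r(k_1;\omega)\cdots r(k_d;\omega)$. Given $\alpha_n\in[0,1]$, $(\mathcal{S},(\alpha_n)_{n\geqslant 0})$ is the probability space on $\mathcal{S}$ with $\sigma$-algebra generated by the events $B^{(n)}=\{\omega: n\in\omega\}$, with $\Pr(B^{(n)})=\alpha_n$ and the $B^{(n)}$ mutually independent. A positive measurable function $g$ defined on some $[\beta,+\infty)$ is $O$-regularly varying if $g(\lambda x)\asymp g(x)$ for every $\lambda>0$. A type-2 function is a real differentiable function $f$ defined on some $[\alpha,+\infty)$ with $f(x)\to+\infty$, such that both $f$ and $f'$ are positive, monotonic and $O$-regularly varying, and $f'$ is bounded. $F\asymp G$ means $F/G$ is bounded above and below by positive constants for large arguments. *)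

(* Defs.v *)
From HB Require Import structures.
From mathcomp Require Import all_boot all_order all_algebra.
From mathcomp Require Import all_classical all_reals all_analysis.

Set Implicit Arguments.
Unset Strict Implicit.
Unset Printing Implicit Defensive.

Import Order.TTheory GRing.Theory Num.Theory.
Import numFieldTopology.Exports numFieldNormedType.Exports.

Local Open Scope classical_set_scope.
Local Open Scope ring_scope.

Definition infsubset : Type := set_type [set A : set nat | infinite_set A].

HB.instance Definition _ := Choice.on infsubset.

Fact infsubset_setT : [set: nat] \in [set A : set nat | infinite_set A].
Proof. by rewrite inE; exact: infinite_nat. Qed.

(* [g_sigma_algebraType] is only a measurable type over a pointed type. *)
HB.instance Definition _ :=
  isPointed.Build infsubset (exist _ [set: nat] infsubset_setT).

Definition mem_event (n : nat) : set infsubset := [set w | val w n].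

Definition infsubset_space := g_sigma_algebraType (range mem_event).

Definition mutually_independent (d : measure_display) (T : measurableType d)
    (R : realType) (P : probability T R) (B : nat -> set T) : Prop :=
  forall s : seq nat, uniq s ->
    P (\bigcap_(i in [set` s]) B i) = (\prod_(i <- s) P (B i))%E.

(* [P] is the measure of the space (S, (alpha_n)); it is unique, and it exists
   only if the series of the [alpha n] diverges. *)
Definition infsubset_law (R : realType) (alpha : nat -> R)
    (P : probability infsubset_space R) : Prop :=
  (forall n, P (mem_event n) = (alpha n)%:E) /\
  mutually_independent P mem_event.

(* The summands of a decomposition of [n] are at most [n], whence ['I_n.+1]. *)
Definition rep (R : realType) (d n : nat) (w : infsubset) : R :=
  \sum_(k : {ffun 'I_d -> 'I_n.+1} | (\sum_(i < d) k i)%N == n)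
    \prod_(i < d) \1_(val w) (k i : nat).

Lemma rep1 (R : realType) (n : nat) (w : infsubset) :
  rep R 1 n w = \1_(val w) n.
Proof.
rewrite /rep (big_pred1 [ffun=> ord_max]) => [|k /=].
  by rewrite big_ord1 ffunE.
rewrite big_ord1; apply/eqP/eqP => [kn|->]; last by rewrite ffunE.
by apply/ffunP => i; rewrite ffunE (ord1 i); apply: val_inj.
Qed.

(* Since [x / 0 = 0], the lower bound forces [g] to be eventually nonzero. *)
Definition asymp (T : Type) (F : set_system T) (R : realType) (f g : T -> R)
    : Prop :=
  exists c C : R, [/\ 0 < c, 0 < C & \forall x \near F, c <= f x / g x <= C].

Definition monotonic_on (R : realType) (A : set R) (g : R -> R) : Prop :=
  {in A &, {homo g : x y / x <= y}} \/ {in A &, {homo g : x y /~ x <= y}}.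

Definition O_regularly_varying (R : realType) (b : R) (g : R -> R) : Prop :=
  [/\ forall x, b <= x -> 0 < g x,
      measurable_fun (`[b, +oo[%classic : set R) g &
      forall lambda, 0 < lambda -> asymp +oo (fun x => g (lambda * x)) g].

(* A function on [a, +oo) is given by a total function whose values below [a]
   are junk.  Two-sided differentiability at [a] is no restriction, as [a] may
   be replaced by [a + 1]. *)
Definition type2_on (R : realType) (a : R) (f : R -> R) : Prop :=
  let D : set R := `[a, +oo[%classic in
  [/\ forall x, D x -> derivable f x 1,
      f x @[x --> +oo] --> +oo,
      [/\ forall x, D x -> 0 < f x, monotonic_on D f &
          O_regularly_varying a f],
      [/\ forall x, D x -> 0 < derive1 f x, monotonic_on D (derive1 f) &
          O_regularly_varying a (derive1 f)] &
      [bounded derive1 f x | x in D]].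

Definition type2 (R : realType) (f : R -> R) : Prop :=
  exists a : R, type2_on a f.

(* Main.v *)
Require Import Defs.
From mathcomp Require Import all_boot all_order all_algebra all_fingroup.
From mathcomp Require Import all_classical all_reals all_analysis.
From mathcomp Require Import lra.
Import Order.TTheory GRing.Theory Num.Theory.
Import numFieldTopology.Exports numFieldNormedType.Exports.
Local Open Scope classical_set_scope.
Local Open Scope ring_scope.

(* By independence, E(r_d(n)) is the sum, over the decompositions
   k_1 + ... + k_d = n, of the product of alpha over the distinct values among
   the k_i.  By monotonicity and O-regular variation, f'(v) is comparable to
   f'(n) for n/d <= v <= n, and by the mean value theorem alpha_0 + ... + alpha_n
   is comparable to f(n).

   Upper bound: some k_i is at least n/d and contributes O(f'(n)).  The other
   entries are chosen one by one, each being either new (total cost O(f(n))) or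
   a repetition of a previous value (O(1) choices), and k_i is then determined
   by the sum.
   Lower bound: let k_2, ..., k_d range over [0, n/d] and put
   k_1 = n - k_2 - ... - k_d, which is at least n/d. *)

(** * Decompositions as lists of values *)

(** Bridge from the finite functions summed in [rep] to lists, on which weights depend and on which
    one can induct by removing the head. *)
Definition ffvals {d n : nat} (k : {ffun 'I_d -> 'I_n}) : seq nat :=
  [seq (k i : nat) | i <- enum 'I_d].

Definition ffcons {T : Type} {d : nat} (x : T) (k : {ffun 'I_d -> T}) :
    {ffun 'I_d.+1 -> T} :=
  [ffun i => oapp k x (unlift ord0 i)].

Lemma ffvals_cons (d n : nat) (x : 'I_n) (k : {ffun 'I_d -> 'I_n}) :
  ffvals (ffcons x k) = (x : nat) :: ffvals k.
Proof.
rewrite /ffvals enum_ordSl /= ffunE unlift_none /=; congr cons.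
by rewrite -map_comp; apply: eq_map => i /=; rewrite ffunE liftK.
Qed.

Lemma sumn_ffvals (d n : nat) (k : {ffun 'I_d -> 'I_n}) :
  sumn (ffvals k) = (\sum_(i < d) k i)%N.
Proof. by rewrite sumnE big_map big_enum. Qed.

Lemma ffvals0 (n : nat) (k : {ffun 'I_0 -> 'I_n}) : ffvals k = [::].
Proof. by apply: size0nil; rewrite size_map size_enum_ord. Qed.

Lemma sum_ffvals0 (R : nmodType) (n : nat) (F : seq nat -> R) :
  \sum_(k : {ffun 'I_0 -> 'I_n}) F (ffvals k) = F [::].
Proof.
rewrite (eq_bigr (fun=> F [::])) => [|k _]; last by rewrite ffvals0.
by rewrite sumr_const card_ffun !card_ord expn0 mulr1n.
Qed.

(** [ffcons] is a bijection, with inverse given by the value at [ord0] and the restriction along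
    [lift ord0]. *)
Lemma sum_ffvalsS (R : nmodType) (d n : nat) (F : seq nat -> R) :
  \sum_(k : {ffun 'I_d.+1 -> 'I_n}) F (ffvals k) =
  \sum_(x < n) \sum_(k : {ffun 'I_d -> 'I_n}) F ((x : nat) :: ffvals k).
Proof.
rewrite pair_big /=.
rewrite (reindex (fun p : 'I_n * {ffun 'I_d -> 'I_n} => ffcons p.1 p.2)) /=.
  by apply: eq_bigr => -[x k] _ /=; rewrite ffvals_cons.
exists (fun k => (k ord0, [ffun i => k (lift ord0 i)])) => [[x k]|k] _ /=.
  congr pair; first by rewrite ffunE unlift_none.
  by apply/ffunP => i; rewrite !ffunE liftK.
apply/ffunP => i; rewrite ffunE; case: unliftP => [j|] -> //=.
by rewrite ffunE.
Qed.

(** * Weights of decompositions and bounds for their sums *)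

(* The probability that all members of [t] belong to the random set, given
   that those of [s] do. *)
Definition cond_weight {R : pzSemiRingType} (alpha : nat -> R) (s t : seq nat) : R :=
  \prod_(x <- undup t | x \notin s) alpha x.

Lemma cond_weight_nil (R : pzSemiRingType) (alpha : nat -> R) (s : seq nat) :
  cond_weight alpha s [::] = 1.
Proof. by rewrite /cond_weight big_nil. Qed.

(** The chain rule for conditional probabilities: once [x] is conditioned upon, its later copies
    cost nothing. *)
Lemma cond_weight_cons (R : comPzSemiRingType) (alpha : nat -> R) (s t : seq nat)
    (x : nat) :
  cond_weight alpha s (x :: t) =
  (if x \in s then 1 else alpha x) * cond_weight alpha (x :: s) t.
Proof.
rewrite /cond_weight.
have -> : \prod_(y <- undup (x :: t) | y \notin s) alpha y =
          \prod_(y <- x :: rem x (undup t) | y \notin s) alpha y.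
  rewrite /=; case: ifPn => xt; last by rewrite rem_id // mem_undup.
  by apply: perm_big; apply: perm_to_rem; rewrite mem_undup.
rewrite big_cons rem_filter ?undup_uniq// big_filter_cond.
rewrite [X in _ = _ * X](eq_bigl (fun y => (y != x) && (y \notin s))) => [|y].
  by case: (x \in s); rewrite /= ?mul1r.
by rewrite inE negb_or.
Qed.

Lemma eq_cond_weight (R : pzSemiRingType) (alpha : nat -> R)
    (s s' t : seq nat) :
  s =i s' -> cond_weight alpha s t = cond_weight alpha s' t.
Proof. by move=> ss'; apply: eq_bigl => x; rewrite ss'. Qed.

Lemma perm_cond_weight (R : comPzSemiRingType) (alpha : nat -> R)
    (s t t' : seq nat) :
  perm_eq t t' -> cond_weight alpha s t = cond_weight alpha s t'.
Proof. by move=> tt'; apply: perm_big; rewrite perm_undup //; exact: perm_mem. Qed.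

Lemma cond_weight_ge0 (R : numDomainType) (alpha : nat -> R) (s t : seq nat) :
  (forall x, 0 <= alpha x) -> 0 <= cond_weight alpha s t.
Proof. by move=> a0; apply: prodr_ge0. Qed.

(** A repeated or already conditioned entry counts as 1 instead of [alpha x], which is at most 1. *)
Lemma cond_weight_ge_prod (R : numDomainType) (alpha : nat -> R)
    (s t : seq nat) :
  (forall x, 0 <= alpha x <= 1) -> \prod_(x <- t) alpha x <= cond_weight alpha s t.
Proof.
move=> a01; elim: t s => [|x t IH] s; first by rewrite big_nil cond_weight_nil.
have [a0 a1] := andP (a01 x).
rewrite big_cons cond_weight_cons ler_pM//.
  by apply: prodr_ge0 => y _; have /andP[] := a01 y.
by case: ifP.
Qed.

(* Each new entry [x] either equals [v], or lies in [s], or is paid for by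
   [alpha x]; once all entries are chosen, [v] is determined. *)
Lemma cond_weight_sum_le (R : numDomainType) (alpha : nat -> R) (n m : nat) :
  (forall x, 0 <= alpha x) ->
  forall (c a : nat) (s : seq nat), (0 < c)%N ->
  \sum_(v < n.+1) \sum_(k : {ffun 'I_m -> 'I_n.+1})
     ((c * v + sumn (ffvals k) + a)%N == n)%:R *
     cond_weight alpha ((v : nat) :: s) (ffvals k)
  <= (1 + (size s + m)%:R + \sum_(x < n.+1) alpha x) ^+ m.
Proof.
(* The induction needs general [c], [a] and [s]: an entry equal to [v] raises the coefficient [c],
   while any other entry is added to [a] and joins [s]. *)
move=> a0; elim: m => [|m IH] c a s c0.
  under eq_bigr => v _ do
    rewrite (sum_ffvals0 _ _ (fun t =>
      ((c * v + sumn t + a)%N == n)%:R * cond_weight alpha ((v : nat) :: s) t))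
      /= addn0 cond_weight_nil mulr1.
  rewrite expr0.
  (* As [c] is positive, at most one [v] solves [c * v + a = n]. *)
  case: (pickP (fun v : 'I_n.+1 => (c * v + a)%N == n)) => [v0 /eqP v0n|none]; last first.
    by rewrite big1 ?ler01// => v _; rewrite none.
  rewrite (bigD1 v0) //= v0n eqxx big1 ?addr0// => v /negP vv0.
  case: (_ =P n) => // vn; case: vv0.
  have /eqP := etrans vn (esym v0n).
  by rewrite eqn_add2r eqn_pmul2l.
set A := \sum_(x < n.+1) alpha x.
have A0 : 0 <= A by apply: sumr_ge0.
set K := (1 + (size s + m.+1)%:R + A) ^+ m.
pose Q (b : nat) (t : seq nat) := \sum_(k : {ffun 'I_m -> 'I_n.+1})
   ((sumn (ffvals k) + b)%N == n)%:R * cond_weight alpha t (ffvals k).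
have Q0 b t : 0 <= Q b t.
  by apply: sumr_ge0 => k _; rewrite mulr_ge0 ?ler0n ?cond_weight_ge0.
have eqQ b t t' : t =i t' -> Q b t = Q b t'.
  by move=> tt'; apply: eq_bigr => k _; rewrite (eq_cond_weight _ _ _ _ _ tt').
(* The conditioning list may gain one element because [m] drops by one: the bound depends on
   [size s + m]. *)
have IHQ c' a' s' : (0 < c')%N -> (size s' <= (size s).+1)%N ->
    \sum_(v < n.+1) Q (c' * v + a')%N ((v : nat) :: s') <= K.
  move=> c'0 ss'; apply: le_trans (_ : _ <= (1 + (size s' + m)%:R + A) ^+ m) _.
    rewrite (le_trans _ (IH c' a' s' c'0))//; apply: ler_sum => v _.
    by apply: ler_sum => k _; rewrite addnCA addnA.
  rewrite lerXn2r ?nnegrE ?addr_ge0 ?ler0n ?ler01//.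
  by rewrite lerD2r lerD2l ler_nat addnS -addSn leq_add2r.
have -> : \sum_(v < n.+1) \sum_(k : {ffun 'I_m.+1 -> 'I_n.+1})
     ((c * v + sumn (ffvals k) + a)%N == n)%:R *
     cond_weight alpha ((v : nat) :: s) (ffvals k)
  = \sum_(v < n.+1) \sum_(x < n.+1)
     (if (x : nat) \in (v : nat) :: s then 1 else alpha x) *
       Q (c * v + (a + x))%N [:: x : nat, v : nat & s].
  apply: eq_bigr => v _.
  rewrite (sum_ffvalsS _ _ _ (fun t =>
      ((c * v + sumn t + a)%N == n)%:R * cond_weight alpha ((v : nat) :: s) t)).
  apply: eq_bigr => x _; rewrite mulr_sumr; apply: eq_bigr => k _ /=.
  rewrite cond_weight_cons mulrCA; congr (_ * (_ * _)); congr ((_ == _)%:R).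
  by rewrite [(x + _)%N]addnC !addnA [(c * v + _)%N]addnC -!addnA [(x + a)%N]addnC.
apply: le_trans (_ : _ <= K + (\sum_(x < n.+1) ((x : nat) \in s)%:R) * K + A * K) _.
  rewrite !mulr_suml.
  apply: le_trans (_ : _ <= \sum_(v < n.+1) \sum_(x < n.+1)
     ((x == v)%:R + (((x : nat) \in s)%:R + alpha x)) *
     Q (c * v + (a + x))%N [:: x : nat, v : nat & s]) _.
    apply: ler_sum => v _; apply: ler_sum => x _; apply: ler_wpM2r => //.
    rewrite in_cons -val_eqE /=; case: eqP => _ /=; first by rewrite lerDl addr_ge0.
    by case: (_ \in s); rewrite /= ?add0r ?lerDl.
  under eq_bigr do under eq_bigr do rewrite mulrDl mulrDl.
  under eq_bigr do rewrite !big_split /=.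
  rewrite !big_split /= -addrA; apply: lerD.
    apply: le_trans (IHQ c.+1 a s isT (leqnSn _)).
    apply: ler_sum => v _; rewrite (bigD1 v)//= eqxx mul1r.
    rewrite big1 => [|x /negPf->]; last by rewrite mul0r.
    rewrite addr0 mulSn [(v + _)%N]addnC -addnA [(v + a)%N]addnC.
    rewrite (eqQ _ _ (nat_of_ord v :: s)) // => y.
    by rewrite !in_cons orbA orbb.
  (* For fixed [x], the inner sum over [v] is an instance of the induction hypothesis with [x] moved
     into [s] and its value into [a]. *)
  by apply: lerD; rewrite exchange_big /=; apply: ler_sum => x _; rewrite -mulr_sumr;
    (apply: ler_wpM2l => //); apply: le_trans (IHQ c (a + x)%N ((x : nat) :: s) c0 (leqnn _));
    apply: ler_sum => v _;
    rewrite (eqQ _ _ [:: nat_of_ord v, nat_of_ord x & s]) // => y; rewrite !in_cons orbCA.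
(* It remains to see that at most [size s] values of [x] lie in [s]. *)
rewrite exprS -{1}[K]mul1r -!mulrDl ler_wpM2r ?exprn_ge0 ?addr_ge0 ?ler0n ?ler01//.
rewrite lerD2r lerD2l -natr_sum ler_nat (leq_trans _ (leq_addr _ _))//.
apply: leq_trans (uniq_leq_size (s1 := [seq x <- iota 0 n.+1 | x \in s]) _ _); last first.
- by move=> x; rewrite mem_filter => /andP[].
- by rewrite filter_uniq// iota_uniq.
rewrite size_filter -sum1_count [leqRHS]big_mkcond.
rewrite -[iota 0 n.+1]/(index_iota 0 n.+1) big_mkord.
by apply: leq_sum => x _; case: (_ \in s).
Qed.

Lemma ffvals_comp_perm (d n : nat) (s : {perm 'I_d}) (k : {ffun 'I_d -> 'I_n}) :
  perm_eq (ffvals [ffun i => k (s i)]) (ffvals k).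
Proof.
rewrite /ffvals.
have -> : [seq nat_of_ord ([ffun i => k (s i)] i) | i <- enum 'I_d] =
          [seq nat_of_ord (k i) | i <- [seq s i | i <- enum 'I_d]].
  by rewrite -[RHS]map_comp; apply: eq_map => i /=; rewrite ffunE.
apply: perm_map; apply: uniq_perm; rewrite ?enum_uniq//.
  by rewrite map_inj_uniq ?enum_uniq//; exact: perm_inj.
move=> i; rewrite mem_enum; apply/mapP; exists (s^-1%g i); rewrite ?mem_enum//.
by rewrite permKV.
Qed.

(* Some entry of a decomposition of [n] is at least [n / d]; by symmetry it may
   be taken to be the first one. *)
Lemma cond_weight_decomp_le (R : numDomainType) (alpha : nat -> R) (n m : nat)
    (B : R) :
  (forall x, 0 <= alpha x) -> 0 <= B ->
  (forall v, (v <= n)%N -> (n <= m.+1 * v)%N -> alpha v <= B) ->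
  \sum_(k : {ffun 'I_m.+1 -> 'I_n.+1})
     (sumn (ffvals k) == n)%:R * cond_weight alpha [::] (ffvals k)
  <= m.+1%:R * (B * (1 + m%:R + \sum_(x < n.+1) alpha x) ^+ m).
Proof.
move=> a0 B0 aB.
pose F t := (sumn t == n)%:R * cond_weight alpha [::] t.
have F0 t : 0 <= F t by rewrite mulr_ge0 ?ler0n ?cond_weight_ge0.
apply: le_trans (_ : _ <= \sum_(k : {ffun 'I_m.+1 -> 'I_n.+1})
   \sum_(i < m.+1) (n <= m.+1 * k i)%N%:R * F (ffvals k)) _.
  apply: ler_sum => k _; rewrite -mulr_suml -[leLHS]mul1r -/(F _).
  have [kn|kn] := eqVneq (sumn (ffvals k)) n; last by rewrite /F (negPf kn) !(mul0r,mulr0).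
  apply: ler_wpM2r => //.
  (* Pigeonhole: if every [m.+1 * k i] were below [n], summing over [i] would give [m.+1 * n]
     strictly below itself. *)
  have [i ki] : exists i, (n <= m.+1 * k i)%N.
    apply/existsP; rewrite -[X in is_true X]negbK negb_exists; apply/negP => /forallP kn'.
    have : (\sum_(i < m.+1) (m.+1 * k i).+1 <= \sum_(i < m.+1) n)%N.
      by apply: leq_sum => i _; rewrite ltnNge kn'.
    under eq_bigr do rewrite -addn1.
    rewrite big_split /= -big_distrr /= -sumn_ffvals kn !sum_nat_const card_ord.
    by rewrite muln1 addnS ltnNge leq_addr.
  by rewrite (bigD1 i)//= ki lerDl sumr_ge0.
rewrite exchange_big /=.
have -> : \sum_(i < m.+1) \sum_(k : {ffun 'I_m.+1 -> 'I_n.+1})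
    (n <= m.+1 * k i)%N%:R * F (ffvals k) =
  \sum_(i < m.+1) \sum_(k : {ffun 'I_m.+1 -> 'I_n.+1})
    (n <= m.+1 * head 0%N (ffvals k))%N%:R * F (ffvals k).
  apply: eq_bigr => i _.
  (* Transposing positions [ord0] and [i] changes neither the sum nor the weight. *)
  pose h (k : {ffun 'I_m.+1 -> 'I_n.+1}) := [ffun j => k (tperm ord0 i j)].
  have hK : involutive h by move=> k; apply/ffunP => j; rewrite !ffunE tpermK.
  rewrite (reindex_inj (inv_inj hK)); apply: eq_bigr => k _.
  have hk : perm_eq (ffvals (h k)) (ffvals k) by exact: ffvals_comp_perm.
  rewrite /F (perm_cond_weight _ _ _ _ _ hk) (perm_sumn hk); congr (_ * _).
  by rewrite ffunE tpermR /ffvals enum_ordSl.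
rewrite sumr_const card_ord -[leLHS]mulr_natl ler_wpM2l ?ler0n//.
rewrite (sum_ffvalsS _ _ _ (fun t => (n <= m.+1 * head 0%N t)%N%:R * F t)) /=.
(* The first entry is now the large one, paid for by [B]; the others are counted with [c = 1],
   [a = 0] and [s] empty. *)
apply: le_trans (ler_wpM2l B0 (cond_weight_sum_le _ alpha n m a0 1 0 [::] isT)).
rewrite mulr_sumr; apply: ler_sum => v _; rewrite mulr_sumr; apply: ler_sum => k _.
rewrite /F /= mul1n addn0 cond_weight_cons /= mulrCA [X in _ <= X]mulrCA ler_wpM2l ?ler0n//.
rewrite mulrA ler_wpM2r ?cond_weight_ge0//.
by case: leqP => nv; rewrite ?mul1r ?mul0r// aB// -ltnS.
Qed.

(* Choosing all entries but the first one below [n / d] leaves a first entry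
   of at least [n / d]. *)
Lemma cond_weight_decomp_ge (R : numDomainType) (alpha : nat -> R) (n m : nat)
    (b : R) :
  (forall x, 0 <= alpha x <= 1) -> 0 <= b ->
  (forall v, (v <= n)%N -> (n <= m.+1 * v)%N -> b <= alpha v) ->
  b * (\sum_(x < (n %/ m.+1).+1) alpha x) ^+ m <=
  \sum_(k : {ffun 'I_m.+1 -> 'I_n.+1})
     (sumn (ffvals k) == n)%:R * cond_weight alpha [::] (ffvals k).
Proof.
move=> a01 b0 ab; set q := (n %/ m.+1)%N.
have a0 x : 0 <= alpha x by have /andP[] := a01 x.
have qn : (m.+1 * q <= n)%N by rewrite mulnC leq_trunc_div.
(* Expanding the power gives one term for each choice of the [m] other entries, all at most [q]. *)
have -> : (\sum_(x < q.+1) alpha x) ^+ m =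
  \sum_(k : {ffun 'I_m -> 'I_n.+1}) \prod_(i < m) ((k i <= q)%N%:R * alpha (k i)).
  rewrite -(bigA_distr_bigA (fun _ (x : 'I_n.+1) => (x <= q)%N%:R * alpha x)).
  rewrite prodr_const card_ord; congr (_ ^+ _).
  rewrite (big_ord_widen n.+1 alpha) ?ltnS ?leq_div// big_mkcond /=.
  by apply: eq_bigr => x _; rewrite ltnS; case: leqP; rewrite ?mul1r ?mul0r.
rewrite (sum_ffvalsS _ _ _ (fun t => (sumn t == n)%:R * cond_weight alpha [::] t)).
rewrite exchange_big mulr_sumr; apply: ler_sum => k _ /=.
have F0 (v : 'I_n.+1) : 0 <=
    (v + sumn (ffvals k) == n)%N%:R * cond_weight alpha [::] (nat_of_ord v :: ffvals k).
  by rewrite mulr_ge0 ?ler0n ?cond_weight_ge0.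
have [/forallP kq|] := boolP [forall i, (k i <= q)%N]; last first.
  rewrite negb_forall => /existsP[i /negPf kq].
  by rewrite (bigD1 i)//= kq !(mul0r,mulr0) sumr_ge0.
have sk : (sumn (ffvals k) <= m * q)%N.
  rewrite sumn_ffvals -[m in (m * q)%N]card_ord -sum_nat_const.
  exact: leq_sum.
have skn : (sumn (ffvals k) <= n)%N.
  by rewrite (leq_trans sk)// (leq_trans _ qn)// leq_mul2r leqnSn orbT.
have vn : (n - sumn (ffvals k) < n.+1)%N by rewrite ltnS leq_subr.
rewrite (bigD1 (Ordinal vn))//= subnK// eqxx mul1r.
apply: le_trans (_ : _ <= cond_weight alpha [::] ((n - sumn (ffvals k))%N :: ffvals k)) _.
  rewrite cond_weight_cons /=; apply: ler_pM => //.
  - by apply: prodr_ge0 => i _; rewrite mulr_ge0 ?ler0n.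
  - apply: ab; first exact: leq_subr.
    (* Writing [S] for the sum of the other entries, [m.+1 * S <= m.+1 * (m * q) <= m * n], so
       [m.+1 * (n - S)] is at least [n]. *)
    rewrite mulnBr leq_subRL; last by rewrite leq_mul2l skn orbT.
    rewrite mulSn [X in (_ <= X)%N]addnC leq_add2r.
    by rewrite (leq_trans (leq_mul (leqnn m.+1) sk))// mulnCA leq_mul2l qn orbT.
  - under eq_bigr do rewrite kq mul1r.
    apply: le_trans (cond_weight_ge_prod _ _ _ _ a01).
    by rewrite /ffvals big_map big_enum.
by rewrite lerDl sumr_ge0.
Qed.

(** * The expectation as a sum of weights *)

Lemma measurable_mem_event (n : nat) :
  measurable (mem_event n : set infsubset_space).
Proof. by apply: sub_sigma_algebra; exists n. Qed.

Lemma prod_indic_mem_event (R : realType) (s : seq nat) (w : infsubset) :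
  \prod_(x <- s) \1_(val w) x = \1_(\bigcap_(x in [set` s]) mem_event x) w :> R.
Proof.
elim: s => [|x s IH].
  by rewrite big_nil classical_sets.set_nil bigcap_set0 indicT.
have -> : [set` x :: s] = x |` [set` s].
  by apply/seteqP; split=> y /=; rewrite inE => /predU1P.
rewrite big_cons IH bigcap_setU1 indicI; congr (_ * _).
Qed.

(** Independence applies to distinct indices only, so repetitions are removed first; this is the
    source of [undup] in [cond_weight]. *)
Lemma probability_mem_events (R : realType) (alpha : nat -> R)
    (P : probability infsubset_space R) (s : seq nat) :
  infsubset_law alpha P ->
  P (\bigcap_(x in [set` s]) mem_event x) = (cond_weight alpha [::] s)%:E.
Proof.
move=> [Pa indP].
have -> : [set` s] = [set` undup s].
  by apply/seteqP; split => x /=; rewrite mem_undup.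
rewrite indP ?undup_uniq// /cond_weight -prodEFin.
by apply: eq_big => x; rewrite ?in_nil ?Pa.
Qed.

(** Linearity of the integral: each product of indicators in [rep] is the indicator of an
    intersection of the events [mem_event]. *)
Lemma expectation_rep (R : realType) (alpha : nat -> R)
    (P : probability infsubset_space R) (d n : nat) :
  infsubset_law alpha P ->
  'E_P[rep R d n]%E = (\sum_(k : {ffun 'I_d -> 'I_n.+1})
    (sumn (ffvals k) == n)%:R * cond_weight alpha [::] (ffvals k))%:E.
Proof.
move=> hP; rewrite unlock.
pose B (k : {ffun 'I_d -> 'I_n.+1}) : set infsubset_space :=
  \bigcap_(x in [set` ffvals k]) mem_event x.
have mB k : measurable (B k).
  by apply: fin_bigcap_measurable => // x _; exact: measurable_mem_event.
have -> : (fun w : infsubset_space => (rep R d n w)%:E) =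
  (fun w => \sum_(k <- index_enum {ffun 'I_d -> 'I_n.+1} | sumn (ffvals k) == n)
    (\1_(B k) w)%:E)%E.
  apply/funext => w; rewrite /rep -sumEFin; apply: eq_big => k; first by rewrite sumn_ffvals.
  by move=> _; rewrite /B -prod_indic_mem_event big_map big_enum.
under eq_integral do rewrite -big_filter.
rewrite ge0_integral_sum//=; last first.
  by move=> k; apply/measurable_realfun.measurable_EFinP;
    exact: measurable_realfun.measurable_indic.
rewrite big_filter big_mkcond -sumEFin; apply: eq_bigr => k _.
rewrite integral_indic// setIT.
case: ifP => _; rewrite ?mul1r ?mul0r//.
exact: probability_mem_events.
Qed.

(** * Regular variation and partial sums *)

(** O-regular variation concerns one dilation factor at a time; monotonicity makes it uniform over
    all ratios between [D^-1] and [D], using the factor [D] alone. *)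
Lemma O_regularly_varying_comparable (R : realType) (b : R) (g : R -> R)
    (D : R) :
  1 <= D -> monotonic_on `[b, +oo[%classic g -> O_regularly_varying b g ->
  exists2 K : R, 0 < K & exists N : nat, forall x y : R,
    N%:R <= x -> N%:R <= y -> x <= D * y -> y <= D * x -> g y <= K * g x.
Proof.
move=> D1 mono [g0 _ gD].
have D0 : 0 < D by exact: lt_le_trans D1.
have [c [C [c0 C0 [M [_ HM]]]]] := gD D D0.
exists (C + c^-1); first by rewrite addr_gt0 ?invr_gt0.
have [N HN] : exists N : nat, forall x, N%:R <= x -> [/\ 0 <= x, M < x & b <= x].
  exists (Num.truncn (Num.max M b)).+1 => x Nx.
  have : Num.max M b < x by apply: lt_le_trans Nx; exact: truncnS_gt.
  by rewrite gt_max => /andP[-> /ltW->]; rewrite (le_trans _ Nx).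
have scaleD x : 0 <= x -> x <= D * x by move=> x0; rewrite ler_peMl.
have inD x : b <= x -> x \in (`[b, +oo[%classic : set R).
  by move=> bx; rewrite inE /= in_itv /= bx.
exists N => x y /HN[x0 Mx bx] /HN[y0 My by_] xDy yDx.
have gx0 := g0 x bx; have gy0 := g0 y by_.
have bDx : b <= D * x := le_trans bx (scaleD x x0).
have bDy : b <= D * y := le_trans by_ (scaleD y y0).
(* If [g] increases, [g y <= g (D * x) <= C * g x]; if it decreases, [c * g y <= g (D * y) <= g x].
   The constant [C + c^-1] serves both cases. *)
rewrite mulrDl; case: mono => mono.
  apply: le_trans (mono _ _ (inD _ by_) (inD _ bDx) yDx) _.
  have /andP[_] := HM x Mx; rewrite ler_pdivrMr// => /le_trans; apply.
  by rewrite lerDl mulr_ge0 ?invr_ge0 ?ltW.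
have gDy : g (D * y) <= g x by apply: mono => //; exact: inD.
have /andP[+ _] := HM y My; rewrite ler_pdivlMr// => /le_trans /(_ gDy) cg.
apply: le_trans (_ : _ <= c^-1 * g x) _; first by rewrite mulrC ler_pdivlMr// mulrC.
by rewrite lerDr mulr_ge0 ?ltW.
Qed.

(** Telescoping from [N] on, with the first [N] terms kept apart. *)
Lemma sum_le_increments (R : numDomainType) (u h : nat -> R) (C : R) (N : nat) :
  (forall n, (N <= n)%N -> u n <= C * (h n.+1 - h n)) ->
  forall n, (N <= n)%N -> \sum_(x < n) u x <= \sum_(x < N) u x + C * (h n - h N).
Proof.
move=> uh; elim=> [|n IH]; first by rewrite leqn0 => /eqP->; rewrite subrr mulr0 addr0.
rewrite leq_eqVlt => /predU1P[->|]; first by rewrite subrr mulr0 addr0.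
rewrite ltnS => Nn; rewrite big_ord_recr /= (le_trans (lerD (IH Nn) (uh n Nn)))//.
by rewrite -addrA -mulrDr [X in _ * X]addrC subrKA.
Qed.

Lemma increments_le_sum (R : numDomainType) (u h : nat -> R) (C : R) (N : nat) :
  0 <= C -> (forall n, 0 <= u n) ->
  (forall n, (N <= n)%N -> h n.+1 - h n <= C * u n) ->
  forall n, (N <= n)%N -> h n - h N <= C * \sum_(x < n) u x.
Proof.
move=> C0 u0 uh; elim=> [|n IH].
  by rewrite leqn0 => /eqP->; rewrite subrr mulr_ge0 ?sumr_ge0.
rewrite leq_eqVlt => /predU1P[->|]; first by rewrite subrr mulr_ge0 ?sumr_ge0.
rewrite ltnS => Nn; rewrite big_ord_recr /= mulrDr (le_trans _ (lerD (IH Nn) (uh n Nn)))//.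
by rewrite [leRHS]addrC subrKA.
Qed.

(** By the mean value theorem the increment is [derive1 f x] for some [x] between [n] and [n + 1],
    and [derive1 f] is comparable at [x] and [n], whose ratio is at most 2. *)
Lemma type2_increments (R : realType) (a : R) (f : R -> R) :
  type2_on a f -> exists2 K : R, 0 < K & exists N : nat, forall n, (N <= n)%N ->
    derive1 f n%:R <= K * (f n.+1%:R - f n%:R) /\
    f n.+1%:R - f n%:R <= K * derive1 f n%:R.
Proof.
move=> [df _ _ [g0 gmono gORV] _].
have [K K0 [N HN]] := O_regularly_varying_comparable _ _ _ _ (ler1n R 2) gmono gORV.
(* [N.+1] forces [n >= 1], whence [n + 1 <= 2 * n]. *)
exists K => //; exists (maxn N.+1 (Num.truncn a).+1) => n; rewrite geq_max => /andP[Nn an].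
have {an}an : a <= n%:R.
  by rewrite ltW// (lt_le_trans (truncnS_gt _))// ler_nat.
have [x] : exists2 x, x \in `[n%:R : R, n.+1%:R]%R &
    f n.+1%:R - f n%:R = derive1 f x * (n.+1%:R - n%:R).
  apply: MVT_segment; first by rewrite ler_nat.
    move=> x; rewrite in_itv /= => /andP[nx _].
    apply: DeriveDef; last by rewrite derive1E.
    by apply: df; rewrite /= in_itv /= (le_trans an (ltW nx)).
  apply: derivable_within_continuous => x; rewrite in_itv /= => /andP[nx _].
  by apply: df; rewrite /= in_itv /= (le_trans an nx).
rewrite in_itv /= => /andP[nx xn] ->.
have -> : n.+1%:R - n%:R = 1 :> R by rewrite -natrB// subSnn.
have n1 : 1 <= n%:R :> R by rewrite ler1n (leq_trans _ Nn).
have N_n : N%:R <= n%:R :> R by rewrite ler_nat ltnW.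
have xn' : x <= n%:R + 1 by rewrite natr1.
by rewrite mulr1; split; apply: HN; lra.
Qed.

(** Eventually [alpha] is comparable to the increments of [f], which telescope; the boundary terms
    are absorbed because [f] tends to infinity. *)
Lemma equiv_derive_sum_asymp (R : realType) (a : R) (f : R -> R)
    (alpha : nat -> R) :
  type2_on a f -> (forall n, 0 <= alpha n) ->
  asymp \oo alpha (fun n => derive1 f n%:R) ->
  asymp \oo (fun n => \sum_(x < n.+1) alpha x) (fun n => f n%:R).
Proof.
move=> hf a0 [c [C [c0 C0 [N1 _ HN1]]]].
have [K K0 [N2 HN2]] := type2_increments _ _ _ hf.
have [df foo [f0 fmono fORV] [g0 gmono gORV] _] := hf.
have [L L0 [N3 HN3]] := O_regularly_varying_comparable _ _ _ _ (ler1n R 2) fmono fORV.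
pose N4 := (Num.truncn a).+1.
pose N := maxn (maxn N1 N2) (maxn N3 N4).+1.
have N4a n : (N <= n)%N -> a <= n%:R.
  rewrite !geq_max => /andP[_]; rewrite gtn_max => /andP[_ an].
  by rewrite ltW// (lt_le_trans (truncnS_gt _))// ler_nat ltnW.
have fn0 n : (N <= n)%N -> 0 < f n%:R.
  by move=> Nn; apply: f0; rewrite /= in_itv /= N4a.
have alphaB n : (N <= n)%N -> c * derive1 f n%:R <= alpha n <= C * derive1 f n%:R.
  move=> Nn; have gn : 0 < derive1 f n%:R by apply: g0; rewrite /= in_itv /= N4a.
  have /= := HN1 n; rewrite ler_pdivlMr// ler_pdivrMr//; apply.
  by move: Nn; rewrite !geq_max -!andbA => /and3P[].
have incr n : (N <= n)%N ->
    derive1 f n%:R <= K * (f n.+1%:R - f n%:R) /\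
    f n.+1%:R - f n%:R <= K * derive1 f n%:R.
  by move=> Nn; apply: HN2; move: Nn; rewrite !geq_max -!andbA => /and3P[].
(* The sum up to [n] included telescopes to [f n.+1%:R], which has to be brought back to
   [f n%:R]. *)
have fS n : (N <= n)%N -> f n.+1%:R <= L * f n%:R.
  rewrite !geq_max => /andP[_]; rewrite gtn_max => /andP[N3n _].
  have n1 : 1 <= n%:R :> R by rewrite ler1n (leq_trans _ N3n).
  have N_n : N3%:R <= n%:R :> R by rewrite ler_nat ltnW.
  by apply: HN3; rewrite -?natr1; lra.
pose S := \sum_(x < N) alpha x.
have S0 : 0 <= S by apply: sumr_ge0.
have upper n : (N <= n)%N -> \sum_(x < n.+1) alpha x <= S + C * K * L * f n%:R.
  move=> Nn.
  have le_incr k : (N <= k)%N -> alpha k <= C * K * (f k.+1%:R - f k%:R).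
    move=> Nk; have /andP[_ /le_trans] := alphaB k Nk; apply.
    by rewrite -mulrA ler_pM2l//; have [] := incr k Nk.
  apply: le_trans (sum_le_increments _ _ (fun k => f k%:R) _ _ le_incr _ (leqW Nn)) _.
  rewrite lerD2l -mulrA ler_pM2l ?mulr_gt0//.
  by rewrite (le_trans _ (fS n Nn))// gerBl ltW// fn0.
have lower n : (N <= n)%N -> f n%:R - f N%:R <= K / c * \sum_(x < n.+1) alpha x.
  move=> Nn.
  have ge_incr k : (N <= k)%N -> f k.+1%:R - f k%:R <= K / c * alpha k.
    move=> Nk; have [_ /le_trans] := incr k Nk; apply.
    rewrite -mulrA ler_pM2l// mulrC ler_pdivlMr// mulrC.
    by have /andP[] := alphaB k Nk.
  apply: le_trans (increments_le_sum _ _ (fun k => f k%:R) _ _ _ a0 ge_incr _ Nn) _.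
    by rewrite ltW// divr_gt0.
  by rewrite ler_pM2l ?divr_gt0// [leRHS]big_ord_recr lerDl.
(* The 2 comes from [f n - f N >= f n / 2] once [f n >= 2 * f N], the summand 1 from [S <= f n]. *)
exists (c / (K * 2)), (1 + C * K * L); split.
- by rewrite divr_gt0 ?mulr_gt0.
- by rewrite addr_gt0 ?mulr_gt0.
have fnat : f (n%:R : R) @[n --> \oo] --> +oo by apply: cvg_comp foo; exact: cvgr_idn.
near=> n.
have Nn : (N <= n)%N by near: n; exact: nbhs_infty_ge.
have Sn : S <= f n%:R by near: n; move/cvgryPge: fnat; apply.
have fNn : f N%:R *+ 2 <= f n%:R by near: n; move/cvgryPge: fnat; apply.
have fn := fn0 n Nn.
rewrite ler_pdivlMr// ler_pdivrMr//; apply/andP; split; last first.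
  by rewrite (le_trans (upper n Nn))// mulrDl mul1r lerD2r.
have fn2 : f n%:R / 2 <= K / c * \sum_(x < n.+1) alpha x.
  by apply: le_trans (lower n Nn); rewrite mulr2n in fNn; lra.
have -> : c / (K * 2) * f n%:R = c / K * (f n%:R / 2).
  by rewrite invfM !mulrA [LHS]mulrAC.
apply: le_trans (ler_wpM2l _ fn2) _; first by rewrite ltW ?divr_gt0.
by rewrite mulrA mulrA divfK ?gt_eqF// divff ?gt_eqF// mul1r.
Unshelve. all: by end_near. Qed.

(** * Two-sided bound for the expected number of representations *)

Theorem theorem3p8 (R : realType) (f : R -> R) (hf : type2 f)
  (alpha : nat -> R) (halpha01 : forall n, 0 <= alpha n <= 1)
  (halpha : alpha n / derive1 f n%:R @[n --> \oo] --> (1 : R))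
  (P : probability infsubset_space R) (hP : infsubset_law alpha P)
  (d : nat) (hd : (1 <= d)%N) :
  asymp \oo (fun n : nat => fine 'E_P[rep R d n])
            (fun n : nat => derive1 f n%:R * f n%:R ^+ (d - 1)).
Proof.
have [a hfa] := hf.
have [_ foo [f0 fmono fORV] [g0 gmono gORV] _] := hfa.
have a0 n : 0 <= alpha n by have /andP[] := halpha01 n.
have near12 : \forall n \near \oo, 2^-1 <= alpha n / derive1 f n%:R <= 2.
  near=> n; apply/andP; split.
    by near: n; apply: (cvgr_ge 1) => //; rewrite invf_lt1// ltr1n.
  by near: n; apply: (cvgr_le 1) => //; rewrite ltr1n.
have alphag : asymp \oo alpha (fun n => derive1 f n%:R).
  by exists 2^-1, 2; split.
have [c [C [c0 C0 [N1 _ HN1]]]] := equiv_derive_sum_asymp _ _ _ _ hfa a0 alphag.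
have [N2 _ HN2] := near12.
case: d hd => // m _; rewrite subn1 /=.
have [K K0 [N3 HN3]] :=
  O_regularly_varying_comparable _ _ _ m.+1%:R (ler1n R m.+1) gmono gORV.
(* The extra factor 2 compensates the rounding in [n %/ m.+1] when [f] is compared there and at
   [n]. *)
have [L L0 [N4 HN4]] :=
  O_regularly_varying_comparable _ _ _ (2 * m.+1)%:R (ler1n R (2 * m.+1)) fmono fORV.
pose N := maxn (maxn N1 N2) (maxn (maxn N3 N4) (Num.truncn a).+1).+1.
have N4a n : (N <= n)%N -> a <= n%:R.
  rewrite !geq_max => /andP[_]; rewrite gtn_max => /andP[_ an].
  by rewrite ltW// (lt_le_trans (truncnS_gt _))// ler_nat ltnW.
have fn0 n : (N <= n)%N -> 0 < f n%:R.
  by move=> Nn; apply: f0; rewrite /= in_itv /= N4a.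
have gn0 n : (N <= n)%N -> 0 < derive1 f n%:R.
  by move=> Nn; apply: g0; rewrite /= in_itv /= N4a.
have NN n : (N <= n)%N -> [/\ (N1 <= n)%N, (N2 <= n)%N, (N3 <= n)%N,
    (N4 <= n)%N & (0 < n)%N].
  rewrite /N geq_max => /andP[]; rewrite geq_max => /andP[-> ->] lt_n.
  have n0 : (0 < n)%N := leq_ltn_trans (leq0n _) lt_n.
  by move: lt_n; rewrite !gtn_max => /andP[/andP[/ltnW-> /ltnW->] _].
have alphaB n : (N <= n)%N -> 2^-1 * derive1 f n%:R <= alpha n <= 2 * derive1 f n%:R.
  move=> Nn; have [_ N2n _ _ _] := NN n Nn.
  by have /= := HN2 n N2n; rewrite ler_pdivlMr ?gn0// ler_pdivrMr ?gn0.
have sumB n : (N <= n)%N ->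
    c * f n%:R <= \sum_(x < n.+1) alpha x <= C * f n%:R.
  move=> Nn; have [N1n _ _ _ _] := NN n Nn.
  by have /= := HN1 n N1n; rewrite ler_pdivlMr ?fn0// ler_pdivrMr ?fn0.
have gB n v : (N <= v)%N -> (v <= n)%N -> (n <= m.+1 * v)%N ->
    derive1 f v%:R <= K * derive1 f n%:R /\ derive1 f n%:R <= K * derive1 f v%:R.
  move=> Nv vn nv; have [_ _ N3v _ _] := NN v Nv.
  have [_ _ N3n _ _] := NN n (leq_trans Nv vn).
  have vn' : (v <= m.+1 * n)%N by rewrite (leq_trans vn)// leq_pmull.
  by split; apply: HN3; rewrite -?natrM ler_nat.
(* Below: [alpha v >= derive1 f n / (2 * K)] for the large entry, and each other entry contributes
   at least [c * f q >= c / L * f n], where [q = n %/ m.+1]. Above: [m.+1] positions for the large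
   entry, of weight at most [2 * K * derive1 f n], and a factor [1 + m + C * f n <= (1 + C) * f n]
   for each other entry. *)
exists (2^-1 / K * (c / L) ^+ m), (m.+1%:R * (2 * K * (1 + C) ^+ m)); split.
- by rewrite !mulr_gt0 ?exprn_gt0 ?divr_gt0 ?invr_gt0.
- by rewrite !mulr_gt0 ?exprn_gt0 ?addr_gt0.
have fnat : f (n%:R : R) @[n --> \oo] --> +oo by apply: cvg_comp foo; exact: cvgr_idn.
near=> n.
(* This puts [n %/ m.+1], and every [v] with [n <= m.+1 * v], beyond the threshold [N]. *)
have mNn : (m.+1 * N <= n)%N by near: n; exact: nbhs_infty_ge.
have fm : 1 + m%:R <= f n%:R by near: n; move/cvgryPge: fnat; apply.
have Nn : (N <= n)%N by rewrite (leq_trans _ mNn)// leq_pmull.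
have Nv v : (n <= m.+1 * v)%N -> (N <= v)%N.
  by move=> nv; rewrite -(leq_pmul2l (ltn0Sn m)) (leq_trans mNn).
have gn := gn0 n Nn; have fn := fn0 n Nn.
rewrite (expectation_rep _ _ _ _ _ hP) /=.
rewrite ler_pdivlMr ?ler_pdivrMr ?mulr_gt0 ?exprn_gt0//.
apply/andP; split; last first.
  apply: le_trans (cond_weight_decomp_le _ alpha n m (2 * K * derive1 f n%:R) a0 _ _) _.
  - by rewrite !mulr_ge0 ?ltW.
  - move=> v vn nv; have /andP[_ /le_trans] := alphaB v (Nv v nv); apply.
    by rewrite -mulrA ler_pM2l//; have [] := gB n v (Nv v nv) vn nv.
  rewrite -[leRHS]mulrA ler_pM2l// -[leRHS]mulrA -[leLHS]mulrA ler_pM2l ?mulr_gt0//.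
  rewrite [leRHS]mulrCA ler_pM2l// -exprMn lerXn2r ?nnegrE//.
  - by rewrite !addr_ge0 ?sumr_ge0.
  - by rewrite mulr_ge0 ?addr_ge0 ?ltW.
  by rewrite mulrDl mul1r lerD//; have /andP[] := sumB n Nn.
apply: le_trans
  (cond_weight_decomp_ge _ alpha n m (2^-1 / K * derive1 f n%:R) halpha01 _ _).
- rewrite [leLHS]mulrACA -exprMn.
  rewrite ler_pM2l ?mulr_gt0 ?invr_gt0//.
  set q := (n %/ m.+1)%N.
  have Nq : (N <= q)%N by rewrite leq_divRL// mulnC.
  rewrite lerXn2r ?nnegrE ?sumr_ge0//; first by rewrite mulr_ge0 ?ltW// divr_gt0.
  have /andP[cq _] := sumB q Nq; apply: le_trans cq.
  rewrite -mulrA ler_pM2l// mulrC ler_pdivrMr// mulrC.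
  have [_ _ _ N4q q0] := NN q Nq; have [_ _ _ N4n _] := NN n Nn.
  apply: HN4; rewrite -?natrM ler_nat//.
    by rewrite (leq_trans (leq_div _ _))// leq_pmull.
  (* With [q >= 1], [n < q.+1 * m.+1 <= 2 * q * m.+1]. *)
  rewrite mulnAC (leq_trans (ltnW (ltn_ceil n (ltn0Sn m))))//.
  by rewrite -/q leq_pmul2r// mul2n -addnn -[q.+1]addn1 leq_add2l.
- by rewrite !mulr_ge0 ?invr_ge0 ?ltW.
move=> v vn nv; have /andP[+ _] := alphaB v (Nv v nv); apply: le_trans.
rewrite -mulrA ler_pM2l ?invr_gt0// mulrC ler_pdivrMr// mulrC.
by have [] := gB n v (Nv v nv) vn nv.
Unshelve. all: by end_near. Qed.
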